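(* Let $n \geq 6$ and $b \geq 2$ be integers and let $k \in \{0,1,\dots,b-1\}$. Then $$\left| \frac{1}{n!} \sum_{r \equiv k \ (\mathrm{mod}\ b)} A(n,r) - \frac{1}{b} \right| \leq \sqrt{\frac{23}{5}} \cdot \frac{1}{\sqrt{n+1}} + \frac{24}{n+1} + \frac{b-1}{b} \exp\left(-\frac{n+1}{12}\left(1-\cos(2\pi/b)\right)\right).$$
   Context: A permutation $\pi$ of $\{1,\dots,n\}$ has a descent at position $i$, where $1 \leq i \leq n-1$, if $\pi(i) > \pi(i+1)$. The Eulerian number $A(n,r)$ is the number of permutations of $\{1,\dots,n\}$ with exactly $r$ descents (so $A(n,r)=0$ unless $0\le r\le n-1$, and the sum over $r$ is finite). *)

(* Defs.v *)
From mathcomp Require Import all_boot all_fingroup.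

Set Implicit Arguments.
Unset Strict Implicit.
Unset Printing Implicit Defensive.

(* Permutations of {1, ..., n} are elements of 'S_n, acting on {0, ..., n-1};
   descents only depend on the relative order, so the shift is harmless. *)
Definition descents (n : nat) (s : 'S_n) : {set 'I_n} :=
  [set i : 'I_n | [exists j : 'I_n, (j == i.+1 :> nat) && (s j < s i)]].

Definition eulerian (n r : nat) : nat :=
  #|[set s : 'S_n | #|descents s| == r]|.

Lemma card_descents_lt (n : nat) (s : 'S_n) : 0 < n -> #|descents s| < n.
Proof.
case: n s => // n s _; rewrite -[X in _ < X]card_ord -cardsT.
apply/proper_card/properP; split; first exact/subsetT.
exists ord_max => //; rewrite inE; apply/existsP => -[j /andP[/eqP ej _]].
by have := ltn_ord j; rewrite ej /= ltnn.
Qed.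

Lemma eulerian_eq0 (n r : nat) : 0 < n -> n <= r -> eulerian n r = 0.
Proof.
move=> n0 nr; apply/eqP; rewrite cards_eq0; apply/eqP/setP => s; rewrite !inE.
by rewrite ltn_eqF // (leq_trans (card_descents_lt s n0)).
Qed.

(* Main.v *)
Require Import Defs.
From mathcomp Require Import all_boot all_order all_algebra all_fingroup.
From mathcomp Require Import all_classical all_reals all_analysis.
From mathcomp Require Import complex ring lra.

Set Implicit Arguments.
Unset Strict Implicit.
Unset Printing Implicit Defensive.

Import Order.TTheory GRing.Theory Num.Theory.
Local Open Scope ring_scope.

(** The proof rests on Harper's theorem: the number of descents of a uniform
    random permutation of n letters is distributed as a sum of independent
    Bernoulli variables. Equivalently, the Eulerian polynomial
    A_n = sum_s X^(des s) splits over the reals, with roots <= 0, so that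
    A_n = n! prod_p (1 - p + p X) with all p in [0, 1] ([eulerian_bernoulli]).

    Real-rootedness goes by induction. Inserting the largest letter into a
    permutation gives the classical recurrence for A_n ([eulerian_polyS]), which
    says that A_(n+1) is the polar derivative (n+1) q + (1 - X) q' of
    q = X A_n with respect to the point 1. A Gauss-Lucas argument shows that a
    polar derivative with respect to 1 of a nonconstant polynomial whose roots
    are all real and < 1 has only real roots ([polar_deriv_real_root]); as A_(n+1) has
    positive values on the positive reals, its roots are <= 0.

    For w on the unit circle each factor satisfies
    |1 - p + p w|^2 = 1 - 2 p (1 - p) (1 - Re w)
                   <= exp (- 2 p (1 - p) (1 - Re w)),
    and sum_p p (1 - p) is the variance (n + 1) / 12 of the number of descents
    ([eulerian_variance]). Hence
    |A_n(w)| <= n! exp (- (n + 1) / 12 (1 - Re w)) ([eulerian_unit_circle_le]).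

    Finally the residue class k modulo b is extracted by averaging over the
    b-th roots of unity ([eulerian_residue_fourier]): the root 1 contributes the
    main term 1 / b, and each of the b - 1 others at most 1 / b times
    exp (- (n + 1) / 12 (1 - cos (2 pi / b))), since 2 pi / b is the smallest
    angle. So the exponential term alone bounds the deviation
    ([eulerian_residue_bound]). *)

(** * Descents and insertion of the largest letter *)

(** The letter [x] stands before the word: taking it as an argument lets the
    recursion see the letter preceding [w]. With [x = 0] no descent is added. *)
Fixpoint seq_des (x : nat) (w : seq nat) : nat :=
  if w is y :: w' then ((y < x) + seq_des y w')%N else 0%N.

Lemma seq_des_sum (x : nat) (w : seq nat) :
  seq_des x w = (\sum_(i < size w) (nth 0 w i < nth 0 (x :: w) i))%N.
Proof.
elim: w x => [|y w IHw] x /=; first by rewrite big_ord0.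
by rewrite big_ord_recl /= IHw.
Qed.

Definition perm_word (n : nat) (s : 'S_n) : seq nat :=
  [seq val (s i) | i <- enum 'I_n].

Lemma size_perm_word (n : nat) (s : 'S_n) : size (perm_word s) = n.
Proof. by rewrite size_map size_enum_ord. Qed.

Lemma nth_perm_word (n : nat) (s : 'S_n) (i : 'I_n) :
  nth 0%N (perm_word s) i = s i.
Proof. by rewrite (nth_map i) ?size_enum_ord // nth_ord_enum. Qed.

Lemma card_descents_word (n : nat) (s : 'S_n) :
  #|descents s| = seq_des 0 (perm_word s).
Proof.
rewrite seq_des_sum size_perm_word -sum1_card big_mkcond /=.
case: n s => [|n] s; first by rewrite !big_ord0.
rewrite big_ord_recr big_ord_recl /= add0n inE.
have -> : [exists j : 'I_n.+1, (j == n.+1 :> nat) && (s j < s ord_max)%N] = false.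
  by apply/existsP => -[j /andP[/eqP jn _]]; have := ltn_ord j; rewrite jn ltnn.
rewrite addn0; apply: eq_bigr => i _; rewrite inE.
have -> : nth 0%N (perm_word s) i = s (widen_ord (leqnSn n) i).
  by rewrite -nth_perm_word.
have -> : nth 0%N (perm_word s) (bump 0 i) = s (lift ord0 i).
  by rewrite -nth_perm_word.
have -> : [exists j : 'I_n.+1, (j == i.+1 :> nat)
             && (s j < s (widen_ord (leqnSn n) i))%N] =
          (s (lift ord0 i) < s (widen_ord (leqnSn n) i))%N.
  apply/existsP/idP => [[j /andP[/eqP ji]]|lts].
    by have -> : j = lift ord0 i by apply: val_inj.
  by exists (lift ord0 i); rewrite lts andbT.
by case: ifP.
Qed.

Lemma perm_word_lift (n : nat) (s : 'S_n) (j : 'I_n.+1) :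
  perm_word (lift_perm j ord_max s) =
  take j (perm_word s) ++ n :: drop j (perm_word s).
Proof.
have le_jn : (j <= n)%N by rewrite -ltnS.
apply: (@eq_from_nth _ 0%N) => [|h].
  by rewrite size_cat /= addnS -size_cat cat_take_drop !size_perm_word.
rewrite size_perm_word => lt_hn; rewrite -[h]/(val (Ordinal lt_hn)).
rewrite nth_perm_word nth_cat size_takel ?size_perm_word //.
case: (unliftP j (Ordinal lt_hn)) => [k|] ->; last first.
  by rewrite lift_perm_id ltnn subnn.
rewrite lift_perm_lift lift_max /= /bump -nth_perm_word.
case: (leqP j k) => [le_jk|lt_kj]; last by rewrite add0n lt_kj nth_take.
rewrite add1n ltnNge leqW //= subSn //= nth_drop subnKC //.
Qed.

(** A letter [m] larger than all others creates no new descent when it is put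
    inside a descent (d places) or at the end (1 place), and exactly one
    in the remaining [size w - d] places. *)
Lemma sum_des_insert (R : comNzRingType) (t : R) (m x : nat) (w : seq nat) :
    (x <= m)%N -> all (fun y => y < m)%N w ->
  let d := seq_des x w in
  \sum_(j < (size w).+1) t ^+ seq_des x (take j w ++ m :: drop j w) =
  t ^+ d * (1 + d%:R) + t ^+ d.+1 * ((size w)%:R - d%:R).
Proof.
move=> + + d; rewrite /d {d}; elim: w x => [|y w IHw] x le_xm /=.
  by move=> _; rewrite big_ord1 /= ltnNge le_xm /= !expr0; ring.
case/andP=> lt_ym lt_wm; rewrite big_ord_recl /= ltnNge le_xm lt_ym /= add0n.
under eq_bigr do rewrite /= exprD.
rewrite -mulr_sumr IHw ?(ltnW lt_ym) //.
by case: (y < x)%N; rewrite -?natr1 ?add0n ?add1n ?expr0 ?expr1 ?exprS; ring.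
Qed.

Definition eulerian_poly (R : comNzRingType) (n : nat) : {poly R} :=
  \sum_(s : 'S_n) 'X^#|descents s|.

Lemma bij_insert_max (n : nat) :
  bijective (fun u : 'I_n.+1 * 'S_n => lift_perm u.1 ord_max u.2).
Proof.
apply: inj_card_bij => [[i s] [j t] /= eq_st|].
  have eq_ij : i = j.
    apply: (@perm_inj _ (lift_perm j ord_max t)).
    by rewrite -[in LHS]eq_st !lift_perm_id.
  rewrite {i}eq_ij in eq_st *; congr pair; apply/permP => k.
  by apply: (@lift_inj _ ord_max); rewrite -!(lift_perm_lift j) eq_st.
by rewrite card_prod card_ord !card_Sn factS.
Qed.

(** Summing [sum_des_insert] over all permutations: since X A' is the
    generating function of d X^d, the factors d turn into a derivative. *)
Lemma eulerian_polyS (R : comNzRingType) (n : nat) (A := eulerian_poly R n) :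
  eulerian_poly R n.+1 = (1 + n%:R * 'X) * A + 'X * (1 - 'X) * A^`().
Proof.
rewrite {1}/eulerian_poly (reindex _ (onW_bij _ (bij_insert_max n))) /=.
rewrite -(pair_bigA _ (fun i s => 'X^#|descents (lift_perm i ord_max s)|)) /=.
rewrite exchange_big /A /eulerian_poly raddf_sum /= !mulr_sumr -big_split /=.
apply: eq_bigr => s _; rewrite card_descents_word.
under eq_bigr do rewrite card_descents_word perm_word_lift.
have lt_wn : all (fun y => y < n)%N (perm_word s).
  by apply/allP => _ /mapP[i _ ->]; exact: ltn_ord.
have := sum_des_insert ('X : {poly R}) (leq0n n) lt_wn.
rewrite size_perm_word => ->; rewrite derivXn -mulr_natr.
by case: (seq_des _ _) => [|d]; rewrite /= ?exprS; ring.
Qed.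

(** * Real-rootedness of Eulerian polynomials *)

Lemma horner_eulerian (R : comNzRingType) (n : nat) (x : R) :
  (eulerian_poly R n).[x] = \sum_(s : 'S_n) x ^+ #|descents s|.
Proof. by rewrite horner_sum; under eq_bigr do rewrite hornerXn. Qed.

Lemma eulerian_poly1 (R : comNzRingType) (n : nat) :
  (eulerian_poly R n).[1] = n`!%:R.
Proof.
rewrite horner_eulerian; under eq_bigr do rewrite expr1n.
by rewrite sumr_const card_Sn.
Qed.

Lemma horner_deriv_prod_XsubC (F : fieldType) (rs : seq F) (z : F)
    (q := \prod_(r <- rs) ('X - r%:P)) : z \notin rs ->
  q^`().[z] = q.[z] * \sum_(r <- rs) (z - r)^-1.
Proof.
rewrite /q {q}; elim: rs => [|r rs IHrs].
  by rewrite !big_nil -polyC1 derivC horner0 mulr0.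
rewrite inE negb_or => /andP[z_r /IHrs eq_rs].
rewrite !big_cons derivM !hornerE derivXsubC hornerC eq_rs.
by field; rewrite subr_eq0.
Qed.

Lemma lt1_real (R : numDomainType) (r : R) : r < 1 -> r \is Num.real.
Proof.
by move=> r_lt1; rewrite -[r](subKr 1) rpredB ?real1 // gtr0_real ?subr_gt0.
Qed.

(** A Gauss-Lucas argument. Outside the roots of [q] the equation reads
    N + (1 - z) sum_r 1 / (z - r) = 0, and (1 - z) / (z - r) is
    (1 - r) / (z - r) - 1, so T = sum_r (1 - r) / (z - r) is real. But the
    imaginary part of T is - Im z times a sum of terms
    (1 - r) / |z - r|^2 > 0, which forces Im z = 0. *)
Lemma polar_deriv_real_root (C : numClosedFieldType) (rs : seq C) (N : nat)
    (z : C) (q := \prod_(r <- rs) ('X - r%:P)) :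
  rs != [::] -> {in rs, forall r, r < 1} ->
  root (N%:R * q + (1 - 'X) * q^`()) z -> z \is Num.real.
Proof.
move=> rs0 rs_lt1 zroot.
have [/rs_lt1/lt1_real //|z_rs] := boolP (z \in rs).
have qz0 : q.[z] != 0 by rewrite -rootE root_prod_XsubC.
have z_r r : r \in rs -> z - r != 0.
  by rewrite subr_eq0 => r_rs; apply: contraNneq z_rs => ->.
pose T := \sum_(r <- rs) (1 - r) / (z - r).
(* The hypothesis on z gives T = deg q - N. *)
have T_real : T \is Num.real.
  have -> : T = (size rs)%:R - N%:R.
    have : N%:R + (1 - z) * \sum_(r <- rs) (z - r)^-1 = 0.
      apply: (mulfI qz0); rewrite mulr0 -[RHS](rootP zroot).
      by rewrite !hornerE horner_deriv_prod_XsubC //= -/q -polyC_natr hornerC; ring.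
    move/(canRL (addKr _)); rewrite addr0 mulr_sumr => T_N.
    rewrite -T_N -sum1_size natr_sum -big_split /= /T.
    by apply: eq_big_seq => r /z_r zr0; field.
  by rewrite rpredB ?realn.
pose S := \sum_(r <- rs) (1 - r) / `|z - r| ^+ 2.
have S_gt0 : 0 < S.
  have term_gt0 r : r \in rs -> 0 < (1 - r) / `|z - r| ^+ 2.
    by move=> r_rs; rewrite divr_gt0 ?subr_gt0 ?rs_lt1 ?exprn_gt0 ?normr_gt0 ?z_r.
  rewrite /S big_seq; case: (rs) rs0 term_gt0 => // r rs' _ term_gt0.
  rewrite big_mkcond big_cons mem_head -big_mkcond.
  apply: ltr_pwDl; first by rewrite term_gt0 ?mem_head.
  by apply: sumr_ge0 => t t_rs; rewrite ltW ?term_gt0.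
(* Every difference 1 / (z^* - r) - 1 / (z - r) has the numerator z - z^*. *)
have eq_T : T^* - T = (z - z^*) * S.
  rewrite /T /S rmorph_sum /= -sumrB mulr_sumr; apply: eq_big_seq => r r_rs.
  have r_real : r^* = r by apply/CrealP/lt1_real/rs_lt1.
  have zJ_r : (z - r)^* != 0 by rewrite conjC_eq0 z_r.
  move: (z_r r r_rs); rewrite normCK fmorph_div !rmorphB rmorph1 /= in zJ_r *.
  by rewrite r_real in zJ_r * => zr0; field; apply/andP; split.
apply/CrealP/eqP; rewrite eq_sym -subr_eq0.
move/eqP: eq_T; rewrite (CrealP T_real) subrr eq_sym mulf_eq0 (gt_eqF S_gt0).
by rewrite orbF.
Qed.

Lemma eulerian_poly0 (R : comNzRingType) : eulerian_poly R 0 = 1.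
Proof.
rewrite /eulerian_poly (eq_bigr (fun=> 1)) ?sumr_const ?card_Sn // => s _.
by rewrite card_descents_word /perm_word (size0nil (size_enum_ord 0)).
Qed.

(** The form of the recurrence that preserves real-rootedness. *)
Lemma eulerian_polyS_polar (R : comNzRingType) (n : nat)
    (q := 'X * eulerian_poly R n) :
  eulerian_poly R n.+1 = n.+1%:R * q + (1 - 'X) * q^`().
Proof. by rewrite eulerian_polyS /q derivM derivX -natr1; ring. Qed.

Lemma eulerian_root_le0 (C : numClosedFieldType) (n : nat) (z : C) :
  root (eulerian_poly C n) z -> z <= 0.
Proof.
elim: n z => [|n IHn] z; first by rewrite eulerian_poly0 rootE hornerE oner_eq0.
move=> zroot; have z_real : z \is Num.real.
  have [rs eq_A] := closed_field_poly_normal (eulerian_poly C n).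
  set c := lead_coef _ in eq_A.
  have c0 : c != 0.
    apply: contraTneq (_ : (eulerian_poly C n).[1] != 0).
      by move=> c0; rewrite eq_A c0 scale0r horner0 eqxx.
    by rewrite eulerian_poly1 pnatr_eq0 -lt0n fact_gt0.
  (* The extra root 0 comes from the factor X in q = X A_n. *)
  apply: (@polar_deriv_real_root _ (0 :: rs) n.+1) => // [r|].
    rewrite inE => /predU1P[->|r_rs]; first exact: ltr01.
    apply: le_lt_trans ltr01; apply: IHn.
    by rewrite eq_A rootZ // root_prod_XsubC.
  rewrite big_cons subr0 -(rootZ _ _ c0) scalerDr !scalerAr -derivZ scalerAr.
  by rewrite -eq_A -eulerian_polyS_polar.
rewrite real_leNgt ?real0 //; apply/negP => z_gt0.
have := rootP zroot; rewrite horner_eulerian; apply/eqP/lt0r_neq0.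
rewrite (bigD1 1%g) //=; apply: ltr_pwDl; first exact: exprn_gt0.
by apply: sumr_ge0 => s _; apply/exprn_ge0/ltW.
Qed.

(** Harper's factorization. A root r <= 0 gives the parameter
    p = 1 / (1 - r), as X - r = (1 - r) (1 - p + p X). *)
Lemma eulerian_bernoulli (C : numClosedFieldType) (n : nat) :
  exists2 ps : seq C, all (fun p => 0 <= p <= 1) ps &
    eulerian_poly C n = n`!%:R *: \prod_(p <- ps) ((1 - p)%:P + p *: 'X).
Proof.
have [rs eq_A] := closed_field_poly_normal (eulerian_poly C n).
set c := lead_coef _ in eq_A.
have A1 := eulerian_poly1 C n.
have rs_le0 : {in rs, forall r, r <= 0}.
  by move=> r r_rs; apply: (@eulerian_root_le0 _ n); rewrite eq_A rootE hornerZ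
    (rootP (_ : root (\prod_(r <- rs) ('X - r%:P)) r)) ?mulr0 // root_prod_XsubC.
have r1_gt0 r : r \in rs -> 0 < 1 - r.
  by move/rs_le0 => r_le0; rewrite subr_gt0 (le_lt_trans r_le0).
exists [seq (1 - r)^-1 | r <- rs].
  apply/allP => _ /mapP[r r_rs ->]; rewrite invr_ge0 ltW ?r1_gt0 //=.
  by rewrite invf_le1 ?r1_gt0 // lerDl oppr_ge0 rs_le0.
rewrite big_map.
have eq_q : \prod_(r <- rs) ('X - r%:P) = (\prod_(r <- rs) (1 - r)) *:
   \prod_(r <- rs) ((1 - (1 - r)^-1)%:P + (1 - r)^-1 *: 'X).
  rewrite -mul_polyC rmorph_prod -big_split /=; apply: eq_big_seq => r r_rs.
  have r1 : 1 - r != 0 by rewrite gt_eqF ?r1_gt0.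
  rewrite mul_polyC scalerDr scalerA divff // scale1r addrC -mul_polyC -polyCM.
  by congr (_ + _); rewrite mulrBr mulr1 divff // addrAC subrr add0r polyCN.
rewrite eq_A eq_q scalerA; congr (_ *: _).
move: A1; rewrite eq_A eq_q scalerA hornerZ horner_prod => <-.
rewrite [X in _ = _ * X]big1 ?mulr1 // => r _.
by rewrite !hornerE; ring.
Qed.

(** * Variance of the number of descents *)

(** The product is the probability generating function of a sum of independent
    Bernoulli variables, so its derivatives at 1 are factorial moments; the last
    identity computes the variance from them. *)
Lemma deriv_prod_bernoulli (R : comNzRingType) (ps : seq R)
    (q := \prod_(p <- ps) ((1 - p)%:P + p *: 'X)) :
  [/\ q.[1] = 1, q^`().[1] = \sum_(p <- ps) p &
     \sum_(p <- ps) p * (1 - p) = q^`()^`().[1] + q^`().[1] - q^`().[1] ^+ 2].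
Proof.
rewrite /q {q}; elim: ps => [|p ps [q1 q'1 q''1]].
  by rewrite !big_nil -polyC1 !derivC !hornerE; split=> //; ring.
rewrite !big_cons q''1; set q := \prod_(_ <- _) _ in q1 q'1 q''1 *.
have eq_d : ((1 - p)%:P + p *: 'X)^`() = p%:P.
  by rewrite derivD derivC derivZ derivX add0r alg_polyC.
rewrite derivM eq_d derivD !derivM derivC eq_d !hornerE /= q1 q'1.
by split; ring.
Qed.

(** Differentiating the recurrence at 1, where the factor X (1 - X) vanishes,
    makes the recurrences for the factorial moments of order 1 and 2 close up. *)
Lemma eulerian_deriv1S (R : comNzRingType) (n : nat) (A := eulerian_poly R n) :
  (eulerian_poly R n.+1)^`().[1] = n%:R * (A.[1] + A^`().[1]) /\
  (eulerian_poly R n.+1)^`()^`().[1] =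
    (2 * n%:R - 2) * A^`().[1] + (n%:R - 1) * A^`()^`().[1].
Proof.
have d1 : (1 : {poly R})^`() = 0 by rewrite -polyC1 derivC.
have dn : (n%:R : {poly R})^`() = 0 by rewrite -polyC_natr derivC.
rewrite eulerian_polyS -/A !(derivM, derivD, derivN, derivX, d1, dn, oppr0, deriv0).
by rewrite -polyC_natr !hornerE /=; split; ring.
Qed.

(** The mean number of descents in [n.+1] letters is n / 2. *)
Lemma eulerian_deriv1 (F : numFieldType) (n : nat) :
  (eulerian_poly F n.+1)^`().[1] = n.+1`!%:R * (n%:R / 2).
Proof.
elim: n => [|n IHn]; first by rewrite (eulerian_deriv1S _ _).1 !mul0r mulr0.
rewrite (eulerian_deriv1S _ _).1 IHn eulerian_poly1 [n.+2`!]factS natrM.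
by rewrite -![_.+1%:R]natr1; field.
Qed.

(** E[D (D - 1)] written as variance + mean^2 - mean. The variance formula fails
    for one letter, whence the shift by 2. *)
Lemma eulerian_deriv2 (F : numFieldType) (n : nat) :
  (eulerian_poly F n.+2)^`()^`().[1] =
  n.+2`!%:R * (n.+3%:R / 12 + (n.+1%:R / 2) ^+ 2 - n.+1%:R / 2).
Proof.
elim: n => [|n IHn].
  by rewrite (eulerian_deriv1S _ _).2 eulerian_deriv1; field.
rewrite (eulerian_deriv1S _ _).2 IHn eulerian_deriv1 [n.+3`!]factS natrM.
by rewrite -![_.+1%:R]natr1; field.
Qed.

Lemma eulerian_variance (F : numFieldType) (n : nat) (ps : seq F) :
  eulerian_poly F n.+2 = n.+2`!%:R *: \prod_(p <- ps) ((1 - p)%:P + p *: 'X) ->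
  \sum_(p <- ps) p * (1 - p) = n.+3%:R / 12.
Proof.
move=> eq_A; have [_ _ ->] := deriv_prod_bernoulli ps.
move: (eulerian_deriv1 F n.+1) (eulerian_deriv2 F n); rewrite eq_A !derivZ !hornerZ.
have fact0 : n.+2`!%:R != 0 :> F by rewrite pnatr_eq0 -lt0n fact_gt0.
by move=> /(mulfI fact0) -> /(mulfI fact0) ->; ring.
Qed.

(** * Decay on the unit circle *)

Lemma normC_bernoulli_factor (C : numClosedFieldType) (p w : C) :
    p \is Num.real -> `|w| = 1 ->
  `|1 - p + p * w| ^+ 2 = 1 - 2 * (p * (1 - p)) * (1 - 'Re w).
Proof.
move=> /CrealP p_real w1; rewrite normCK rmorphD rmorphM rmorphB rmorph1 /= p_real.
have ww : w * w^* = 1 by rewrite -normCK w1 expr1n.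
rewrite ReE; transitivity ((1 - p) ^+ 2 + p ^+ 2 * (w * w^*) + p * (1 - p) * (w + w^*)).
  by ring.
by rewrite ww; field.
Qed.

Lemma normC_eulerian_sqr (C : numClosedFieldType) (n : nat) (w : C) (ps : seq C) :
    all (fun p => 0 <= p <= 1) ps -> `|w| = 1 ->
    eulerian_poly C n = n`!%:R *: \prod_(p <- ps) ((1 - p)%:P + p *: 'X) ->
  `|(eulerian_poly C n).[w]| ^+ 2 =
    n`!%:R ^+ 2 * \prod_(p <- ps) (1 - 2 * (p * (1 - p)) * (1 - 'Re w)).
Proof.
move=> /allP ps01 w1 ->; rewrite hornerZ normrM exprMn normr_nat; congr (_ * _).
rewrite horner_prod normr_prod -prodrXl; apply: eq_big_seq => p /ps01/andP[p0 _].
by rewrite !hornerE normC_bernoulli_factor ?ger0_real //= mulrA.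
Qed.

(** * Extraction of a residue class *)

Lemma sum_eulerian_residue (R : comNzRingType) (n b k : nat) : (0 < n)%N ->
  \sum_(0 <= r < n | r == k %[mod b]) (eulerian n r)%:R =
  \sum_(s : 'S_n) (#|descents s| == k %[mod b])%:R :> R.
Proof.
move=> n_gt0; rewrite big_mkord.
transitivity (\sum_(r < n | r == k %[mod b]) \sum_(s : 'S_n)
    (#|descents s| == r)%:R : R).
  apply: eq_bigr => r _; rewrite /eulerian -sum1_card natr_sum big_mkcond /=.
  by apply: eq_bigr => s _; rewrite inE; case: eqP.
rewrite exchange_big; apply: eq_bigr => s _.
rewrite big_mkcond (bigD1 (Ordinal (card_descents_lt s n_gt0))) //= eqxx.
rewrite big1 ?addr0 => [|r r_s]; first by case: ifP.
have /negPf-> : #|descents s| != r.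
  by apply: contraNneq r_s => des_r; apply/eqP/val_inj.
by rewrite if_same.
Qed.

Lemma sum_prim_root_expr (F : fieldType) (b m : nat) (w : F) :
  b.-primitive_root w -> \sum_(j < b) w ^+ (j * m) = b%:R * (b %| m)%:R.
Proof.
move=> prim_w; under eq_bigr do rewrite mulnC exprM.
rewrite (prim_order_dvd prim_w); have [->|wm1] := eqVneq.
  by under eq_bigr do rewrite expr1n; rewrite sumr_const card_ord mulr1.
move/eqP: (subrX1 (w ^+ m) b).
rewrite -exprM mulnC exprM (prim_expr_order prim_w) expr1n subrr eq_sym.
by rewrite mulf_eq0 subr_eq0 (negPf wm1) mulr0 => /eqP.
Qed.

(** The average over j of w^(j (des s + b - k)) detects whether b divides
    des s + b - k; shifting by b - k instead of - k keeps exponents natural. *)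
Lemma eulerian_residue_fourier (F : fieldType) (n b k : nat) (w : F) :
    (0 < n)%N -> (k < b)%N -> b.-primitive_root w ->
  b%:R * \sum_(0 <= r < n | r == k %[mod b]) (eulerian n r)%:R =
  \sum_(j < b) w ^+ (j * (b - k)) * (eulerian_poly F n).[w ^+ j].
Proof.
move=> n_gt0 lt_kb prim_w; rewrite sum_eulerian_residue // mulr_sumr.
under [RHS]eq_bigr do rewrite horner_eulerian mulr_sumr.
rewrite exchange_big; apply: eq_bigr => s _ /=.
under eq_bigr do rewrite -exprM -exprD -mulnDr.
rewrite sum_prim_root_expr // addnC -(eqn_modDr (b - k)) subnKC ?(ltnW lt_kb) //.
by rewrite modnn.
Qed.

(** The factors 1 - 2 p (1 - p) (1 - Re w) lie between 0 and
    exp (- 2 p (1 - p) (1 - Re w)); multiplying them adds up the variances. The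
    parameters given by [eulerian_bernoulli] are complex numbers that happen to be
    real, so they are first transported to [R]. *)
Lemma eulerian_unit_circle_le (R : realType) (n : nat) (w : R[i]) : `|w| = 1 ->
  `|(eulerian_poly R[i] n.+2).[w]| <=
  (n.+2`!%:R * expR (- (n.+3%:R / 12 * (1 - complex.Re w))))%:C%C.
Proof.
move=> w1; have [ps ps01 eq_A] := eulerian_bernoulli R[i] n.+2.
pose qs := [seq complex.Re p | p <- ps].
have eq_ps : ps = [seq q%:C%C | q <- qs].
  rewrite -map_comp -[LHS]map_id; apply/eq_in_map => p.
  by move/(allP ps01)/andP => [p0 _] /=; rewrite RRe_real ?ger0_real.
have qs01 q : q \in qs -> 0 <= q <= 1.
  move=> q_qs; have /(allP ps01): q%:C%C \in ps by rewrite eq_ps map_f.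
  by rewrite -[1]/(1%:C%C) ler0c lecR.
clearbody qs; set c := complex.Re w.
have c1 : -1 <= c <= 1.
  rewrite -ler_norml -lecR; apply: le_trans (normc_ge_Re w) _; by rewrite w1.
have var_q : \sum_(q <- qs) q * (1 - q) = n.+3%:R / 12.
  apply: complexI; rewrite rmorph_sum rmorphM fmorphV !rmorph_nat /=.
  rewrite -(eulerian_variance eq_A) {1}eq_ps big_map.
  by apply: eq_bigr => q _; rewrite rmorphM rmorphB rmorph1.
rewrite -ler_sqr ?nnegrE ?normr_ge0 ?ler0c ?mulr_ge0 ?ler0n ?expR_ge0 //.
rewrite (normC_eulerian_sqr ps01 w1 eq_A) -complexRe -/c -(rmorphXn (real_complex R)) exprMn.
rewrite eq_ps big_map.
have -> : n.+2`!%:R ^+ 2 * \prod_(q <- qs)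
    (1 - 2 * (q%:C%C * (1 - q%:C%C)) * (1 - c%:C%C)) =
   (n.+2`!%:R ^+ 2 * \prod_(q <- qs) (1 - 2 * (q * (1 - q)) * (1 - c)))%:C%C.
  rewrite rmorphM rmorphXn rmorph_nat rmorph_prod; congr (_ * _).
  by apply: eq_bigr => q _; rewrite !(rmorphM, rmorphB, rmorph1, rmorph_nat).
rewrite lecR ler_wpM2l ?sqr_ge0 //.
have -> : expR (- (n.+3%:R / 12 * (1 - c))) ^+ 2 =
    \prod_(q <- qs) expR (- (2 * (q * (1 - q)) * (1 - c))).
  rewrite -expRM_natl -expR_sum -var_q; congr expR.
  by rewrite sumrN -mulr_suml -mulr_sumr; ring.
rewrite big_seq [leRHS]big_seq; apply: ler_prod => q /qs01/andP[q0 q1].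
rewrite expR_ge1Dx andbT; case/andP: c1 => cN1 c1.
(* The factor is nonnegative because q (1 - q) <= 1 / 4 and 1 - c <= 2. *)
have le_q : q * (1 - q) <= 1 / 4 by have := sqr_ge0 (q - 1 / 2); nra.
have : 2 * (q * (1 - q)) * (1 - c) <= 2 * (1 / 4) * 2.
  by apply: ler_pM; rewrite ?mulr_ge0 ?subr_ge0 //; lra.
lra.
Qed.

(** * Roots of unity of a given angle *)

Definition unit_circle_pt (R : realType) (t : R) : R[i] := (cos t +i* sin t)%C.

Lemma unit_circle_ptX (R : realType) (t : R) (j : nat) :
  unit_circle_pt t ^+ j = unit_circle_pt (j%:R * t).
Proof.
elim: j => [|j IHj]; first by rewrite expr0 mul0r /unit_circle_pt cos0 sin0.
rewrite exprSr IHj -natr1 mulrDl mul1r /unit_circle_pt cosD sinD.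
by apply/eqP; rewrite eq_complex /= eqxx addrC eqxx.
Qed.

Lemma norm_unit_circle_pt (R : realType) (t : R) : `|unit_circle_pt t| = 1.
Proof. by rewrite normc_def /= cos2Dsin2 sqrtr1. Qed.

Lemma cos_2pi_div_lt1 (R : realType) (b : nat) : (2 <= b)%N ->
  cos (2 * pi / b%:R) < 1 :> R.
Proof.
move=> b_ge2; have b2 : 2 <= b%:R :> R by rewrite ler_nat.
have pi0 := pi_gt0 R.
have t0 : 0 < 2 * pi / b%:R :> R by rewrite divr_gt0 ?mulr_gt0 //; lra.
have t_le : 2 * pi / b%:R <= pi :> R by rewrite ler_pdivrMr; nra.
by rewrite -[X in _ < X]cos0 ltr_cos // in_itv /= ?lexx ?pi_ge0 // (ltW t0).
Qed.

(** Among the nontrivial b-th roots of unity, those next to 1 have the largest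
    real part: by symmetry the angle may be taken in [0, pi], where the cosine
    decreases. *)
Lemma cos_multiple_le (R : realType) (b j : nat) : (0 < j < b)%N ->
  cos (j%:R * (2 * pi / b%:R)) <= cos (2 * pi / b%:R) :> R.
Proof.
move=> /andP[j_gt0 lt_jb]; set t : R := 2 * pi / b%:R.
have b0 : 0 < b%:R :> R by rewrite ltr0n (leq_ltn_trans _ lt_jb).
have pi0 := pi_gt0 R.
have bt : b%:R * t = pi *+ 2 by rewrite /t mulr2n; field; rewrite gt_eqF.
have t0 : 0 <= t by rewrite divr_ge0 ?mulr_ge0 ?ltW.
(* Replacing j by b - j changes the angle t into 2 pi - t. *)
wlog le_jb2 : j j_gt0 lt_jb / (j.*2 <= b)%N => [half|].
  have [/half->//|lt_bj2] := leqP j.*2 b.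
  have -> : cos (j%:R * t) = cos ((b - j)%:R * t).
    by rewrite natrB ?(ltnW lt_jb) // mulrBl bt cosB cos2pi sin2pi mul1r mul0r addr0.
  apply: half; rewrite ?subn_gt0 //.
    by rewrite ltn_subrL j_gt0 (ltn_trans j_gt0).
  by rewrite doubleB leq_subLR -addnn leq_add2r ltnW.
have le1 : t <= j%:R * t by rewrite ler_peMl // ler1n.
have le2 : j%:R * t <= pi.
  have : (j.*2)%:R <= b%:R :> R by rewrite ler_nat.
  rewrite -addnn natrD => le_jb.
  have : (j%:R + j%:R) * t <= pi *+ 2 by rewrite -bt ler_wpM2r.
  by rewrite mulr2n; lra.
rewrite leNgt ltr_cos ?in_itv /= -?leNgt //; apply/andP; split=> //.
  exact: le_trans le1.
exact: le_trans le1 le2.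
Qed.

Lemma prim_root_unit_circle (R : realType) (b : nat) : (2 <= b)%N ->
  b.-primitive_root (unit_circle_pt (2 * pi / b%:R) : R[i]).
Proof.
move=> b_ge2; have b_gt0 : (0 < b)%N by exact: ltnW.
set t : R := 2 * pi / b%:R.
have bt : b%:R * t = pi *+ 2.
  by rewrite /t mulr2n; field; rewrite pnatr_eq0 -lt0n.
apply/andP; split=> //; apply/forallP => j; rewrite unity_rootE unit_circle_ptX.
have [->|neq_jb] := eqVneq j.+1 b.
  by rewrite bt /unit_circle_pt cos2pi sin2pi eqxx.
have lt_jb : (0 < j.+1 < b)%N by rewrite /= ltn_neqAle neq_jb ltn_ord.
apply/eqP/negP; rewrite eq_complex /= => /andP[/eqP cos1 _].
have := le_lt_trans (cos_multiple_le R lt_jb) (cos_2pi_div_lt1 R b_ge2).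
by rewrite cos1 ltxx.
Qed.

(** * The residue bound *)

(** In [eulerian_residue_fourier] the summand at j = 0 is n!, and each other one
    is bounded by [eulerian_unit_circle_le] and [cos_multiple_le]. *)
Lemma eulerian_residue_bound (R : realType) (n b k : nat) :
    (2 <= n)%N -> (2 <= b)%N -> (k < b)%N ->
  `| (n`!)%:R^-1 * (\sum_(0 <= r < n | r == k %[mod b]) (eulerian n r)%:R)
     - b%:R^-1 |
  <= (b%:R - 1) / b%:R
       * expR (- ((n.+1)%:R / 12 * (1 - cos (2 * pi / b%:R)))) :> R.
Proof.
case: n => [|[|n]] // _ b_ge2 lt_kb; set S := \sum_(_ <= _ < _ | _) _.
set t : R := 2 * pi / b%:R; set e := expR _.
have b_gt0 : 0 < b%:R :> R by rewrite ltr0n ltnW.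
have f_gt0 : 0 < n.+2`!%:R :> R by rewrite ltr0n fact_gt0.
suff : `|b%:R * S - n.+2`!%:R| <= (b%:R - 1) * (n.+2`!%:R * e).
  have -> : n.+2`!%:R^-1 * S - b%:R^-1 =
      (b%:R * n.+2`!%:R)^-1 * (b%:R * S - n.+2`!%:R).
    by field; rewrite !gt_eqF.
  rewrite normrM gtr0_norm ?invr_gt0 ?mulr_gt0 // => le_S.
  have -> : (b%:R - 1) / b%:R * e =
      (b%:R * n.+2`!%:R)^-1 * ((b%:R - 1) * (n.+2`!%:R * e)).
    by field; rewrite !gt_eqF.
  by rewrite ler_wpM2l // invr_ge0 mulr_ge0 ltW.
pose w := unit_circle_pt t.
have prim_w : b.-primitive_root w by exact: prim_root_unit_circle.
have := eulerian_residue_fourier (ltn0Sn n.+1) lt_kb prim_w.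
case: b b_ge2 lt_kb @t @e @w prim_w @S b_gt0 => // b b_ge2 lt_kb t e w prim_w S _.
rewrite big_ord_recl mul0n !expr0 mul1r eulerian_poly1.
move/(canLR (addKr _)); rewrite addrC => eq_S.
have {eq_S} eq_S : (b.+1%:R * S - n.+2`!%:R)%:C%C = 
   \sum_(i < b) w ^+ (lift ord0 i * (b.+1 - k)) *
              (eulerian_poly R[i] n.+2).[w ^+ lift ord0 i].
  rewrite -eq_S rmorphB rmorphM !rmorph_nat rmorph_sum; congr (_ * _ - _).
  by apply: eq_bigr => r _; rewrite rmorph_nat.
have -> : `|b.+1%:R * S - n.+2`!%:R| = complex.Re `|(b.+1%:R * S - n.+2`!%:R)%:C%C|.
  by rewrite normc_def /= expr0n addr0 sqrtr_sqr.
rewrite -lecR RRe_real ?normr_real // eq_S.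
apply: le_trans (ler_norm_sum _ _ _) _.
have -> : ((b.+1%:R - 1) * (n.+2`!%:R * e))%:C%C =
    \sum_(i < b) (n.+2`!%:R * e)%:C%C.
  by rewrite -rmorph_sum sumr_const card_ord -natr1 addrK mulr_natl.
apply: ler_sum => i _; rewrite normrM normrX norm_unit_circle_pt expr1n mul1r.
apply: le_trans (eulerian_unit_circle_le _ _) _.
  by rewrite normrX norm_unit_circle_pt expr1n.
rewrite lecR ler_wpM2l ?ler0n // ler_expR lerN2 ler_wpM2l ?divr_ge0 ?ler0n //.
by rewrite lerB // unit_circle_ptX cos_multiple_le //= ltnS.
Qed.

Theorem theorem2p1 (R : realType) (n b k : nat)
    (hn : (6 <= n)%N) (hb : (2 <= b)%N) (hk : (k < b)%N) :
  `| (n`!)%:R^-1 * (\sum_(0 <= r < n | r == k %[mod b]) (eulerian n r)%:R)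
     - b%:R^-1 |
  <= Num.sqrt (23 / 5) * (1 / Num.sqrt (n.+1)%:R) + 24 / (n.+1)%:R
     + (b%:R - 1) / b%:R
       * expR (- ((n.+1)%:R / 12 * (1 - cos (2 * pi / b%:R)))) :> R.
Proof.
apply: le_trans (eulerian_residue_bound R (leq_trans _ hn) hb hk) _ => //.
by rewrite lerDr addr_ge0 ?mulr_ge0 ?divr_ge0 ?sqrtr_ge0 ?ler0n.
Qed.
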